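(* Let $0<q<1$, let $m,s_1,\dots,s_m\in\mathbb{N}_0$ and $s_{m+1}\in\mathbb{N}$ (so $s_{m+1}\ge1$). Then $$\zeta_q^*[\{2\}^{s_1},1,\dots,\{2\}^{s_m},1,\{2\}^{s_{m+1}}]=\sum_{\mathbf{p}=(2s_1+1)\circ\cdots\circ(2s_m+1)\circ(2s_{m+1})}\bar{\mathfrak{z}}_q[\mathbf{p};\tilde{\mathbf{p}}],$$ where the sum runs over all $2^{m}$ choices of each symbol $\circ$ as either ''comma'' or ''plus'', and for each such choice $\tilde{\mathbf{p}}:=(s_1+1)\circ\cdots\circ(s_m+1)\circ(s_{m+1})$ is formed with exactly the same choice of commas and pluses as $\mathbf{p}$.
   Context: $[n]_q=\frac{1-q^n}{1-q}$. $\{2\}^a$ denotes the string $2,\dots,2$ ($a$ times; empty if $a=0$). $\zeta_q^*[s_1,\dots,s_r]=\sum_{k_1\ge k_2\ge\cdots\ge k_r\ge1}\prod_{j=1}^r\frac{q^{k_j}}{[k_j]_q^{s_j}}$. For integer tuples $\mathbf{s}=(s_1,\dots,s_r)$, $\mathbf{t}=(t_1,\dots,t_r)$ with $r\ge1$, $\bar{\mathfrak{z}}_q[\mathbf{s};\mathbf{t}]=\sum_{k_1>k_2>\cdots>k_r\ge1}(-1)^{k_r-1}q^{k_1^2-k_r(k_r-1)/2}\prod_{j=1}^r\frac{(1+q^{k_j})q^{(t_j-1)k_j}}{[k_j]_q^{s_j}}$. A string $a_1\circ\cdots\circ a_{r}$ with each $\circ$ a comma or a plus denotes the tuple obtained by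 adding together consecutive entries joined by a plus and separating entries joined by a comma. *)

(* Defs.v *)
From HB Require Import structures.
From mathcomp Require Import all_boot all_order all_algebra.
From mathcomp Require Import all_classical all_reals all_analysis.

Set Implicit Arguments.
Unset Strict Implicit.
Unset Printing Implicit Defensive.

Import Order.TTheory GRing.Theory Num.Theory.
Import numFieldTopology.Exports.

Local Open Scope ring_scope.

Definition qnat (R : realType) (q : R) (n : nat) : R :=
  (1 - q ^+ n) / (1 - q).

(* Multiple series are read as limits, as n tends to infinity, of their (finite)
   truncations k_1 <= n. A multi-index (k_1, ..., k_r) with entries in {0, ..., n}
   is an r-tuple over 'I_n.+1; k_j and s_j are the entries number j - 1 of the
   sequences k and s. *)

Definition zeta_star_trunc (R : realType) (q : R) (s : seq int) (n : nat) : R :=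
  \sum_(k : (size s).-tuple 'I_n.+1 |
          let k' := [seq val i | i <- k] in
          sorted geq k' && all (leq 1) k')
    \prod_(j < size s) (q ^+ tnth k j / qnat q (tnth k j) ^ s`_j).

Definition zeta_star (R : realType) (q : R) (s : seq int) : R :=
  limn (zeta_star_trunc q s).

(* The general term of the series z-bar, with k_1 = head 0 k, k_r = last 0 k
   and r = size s. On the range k_1 >= k_r >= 1 of summation, the
   subtractions in nat are exact, as is the halving of k_r (k_r - 1). *)
Definition zbar_term (R : realType) (q : R) (s t : seq int) (k : seq nat) : R :=
  let k1 := head 0%N k in
  let kr := last 0%N k in
  (-1) ^+ (kr - 1)%N * q ^+ (k1 ^ 2 - (kr * (kr - 1))./2)%N *
  \prod_(j < size s)
    ((1 + q ^+ nth 0%N k j) * q ^ ((t`_j - 1) * (nth 0%N k j)%:Z)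
       / qnat q (nth 0%N k j) ^ s`_j).

(* Meant for nonempty s and t of the same size. *)
Definition zbar_trunc (R : realType) (q : R) (s t : seq int) (n : nat) : R :=
  \sum_(k : (size s).-tuple 'I_n.+1 |
          let k' := [seq val i | i <- k] in
          sorted gtn k' && all (leq 1) k')
    zbar_term q s t [seq val i | i <- k].

Definition zbar (R : realType) (q : R) (s t : seq int) : R :=
  limn (zbar_trunc q s t).

(* compose c [:: a_1; ...; a_r] is the tuple a_1 o ... o a_r, the i-th symbol o
   being a plus if the i-th entry of c is true and a comma if it is false. Meant
   for size a = (size c).+1. *)
Fixpoint compose (c : seq bool) (a : seq int) : seq int :=
  match c, a with
  | plus :: c', x :: a' =>
      let b := compose c' a' in
      if plus then (x + head 0 b) :: behead b else x :: b
  | _, _ => a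
  end.

(* {2}^{s_1}, 1, ..., {2}^{s_m}, 1, {2}^{u} for s = [:: s_1; ...; s_m];
   u stands for s_{m+1}. *)
Definition star_string (s : seq nat) (u : nat) : seq int :=
  flatten [seq rcons (nseq a 2%:Z) 1%:Z | a <- s] ++ nseq u 2%:Z.

Definition p_entries (s : seq nat) (u : nat) : seq int :=
  rcons [seq (2 * a + 1)%N%:Z | a <- s] (2 * u)%N%:Z.

Definition ptilde_entries (s : seq nat) (u : nat) : seq int :=
  rcons [seq (a + 1)%N%:Z | a <- s] u%:Z.

(* Main.v *)
(** Weight the index k_1 of the right-hand side by the ratio
    (q)_n^2 / ((q)_{n-k_1} (q)_{n+k_1}) of q-binomial coefficients. The resulting
    finite sum, taken over all the choices of commas and pluses at once, is
    exactly the truncation of the left-hand side at k_1 <= n: prepending a 2 or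
    a 1 to the string changes both sides by the same recursion in n, because
    the increment of the weight in n is q^(n-k) ([k]/[n])^2 times the weight,
    and the empty string gives an alternating sum that telescopes to 1. As n
    tends to infinity the weights tend to 1, with an error that is dominated by
    the decay q^(2k) of the terms. *)

Require Import Defs.
From HB Require Import structures.
From mathcomp Require Import all_boot all_order all_algebra.
From mathcomp Require Import all_classical all_reals all_analysis.
From mathcomp Require Import ring lra zify.

Set Implicit Arguments.
Unset Strict Implicit.
Unset Printing Implicit Defensive.

Import Order.TTheory GRing.Theory Num.Theory.
Import numFieldTopology.Exports.

Local Open Scope ring_scope.

(** * Merging the entries of a string at its plus signs *)

Lemma size_compose (c : seq bool) (a b : seq int) :
  size a = size b -> size (compose c a) = size (compose c b).
Proof.
elim: c a b => [|p c IH] [|x a] [|y b] //= [/IH E].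
by case: p; rewrite /= ?size_behead E.
Qed.

(** A plus adds two entries that are at least [d], and the result stays at least [d] because
    [0 <= d]. Used with [d] equal to 0 and to 1. *)
Lemma compose_ge (d : int) (c : seq bool) (a : seq int) : 0 <= d ->
  size a = (size c).+1 -> all (>= d) a -> all (>= d) (compose c a).
Proof.
move=> d0; elim: c a => [|p c IH] [|x a] //= [/IH{}IH] /andP[dx /IH].
case: p => /=; last by rewrite dx.
by case: (compose c a) => [|y b] /=; rewrite ?addr0 ?dx // => /andP[dy ->]; lia.
Qed.

Lemma compose_neq_nil (c : seq bool) (a : seq int) :
  (0 < size a)%N -> (0 < size (compose c a))%N.
Proof. by case: c => [|[] c]; case: a. Qed.

(** * Sums over tuples and over decreasing chains *)

Lemma big_tuple_cons (V : nmodType) (T : finType) r (P : seq T -> bool)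
    (F : seq T -> V) :
  \sum_(k : r.+1.-tuple T | P k) F k =
  \sum_(x : T) \sum_(k : r.-tuple T | P (x :: k)) F (x :: k).
Proof.
rewrite pair_big_dep /=.
rewrite (reindex (fun xk : T * r.-tuple T => cons_tuple xk.1 xk.2)) //=.
exists (fun k => (thead k, behead_tuple k)) => [[x k] _|k _] /=.
  by rewrite theadE; congr pair; apply: val_inj.
by rewrite [RHS]tuple_eta; apply: val_inj.
Qed.

Lemma sum_tuple0 (V : nmodType) (T : finType) (P : seq T -> bool) (F : seq T -> V) :
  \sum_(k : 0.-tuple T | P k) F k = if P [::] then F [::] else 0.
Proof.
rewrite (eq_bigl (fun k => (k == [tuple]) && P k)) => [|k].
  rewrite big_mkcondr /= (eq_bigl (pred1 [tuple])) ?big_pred1_eq //.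
by rewrite tuple0 eqxx.
Qed.

Lemma sum_ord_range (V : nmodType) N n (F : nat -> V) : (n <= N.+1)%N ->
  \sum_(x < N.+1) (if (x < n)%N && (1 <= x)%N then F x else 0) =
  \sum_(1 <= x < n) F x.
Proof.
move=> nN; rewrite -big_mkcond /= -(big_mkord (fun x => (x < n)%N && (1 <= x)%N)).
by rewrite (big_nat_widen _ _ _ _ _ nN) (big_nat_widenl 1 0).
Qed.

(** The seed [n] bounds the first index, so removing the head of a chain leaves a chain bounded by
    that head. *)
Definition chain (e : rel nat) n (k : seq nat) := path e n k && all (leq 1) k.

Lemma chain_cons (e : rel nat) n x k :
  chain e n (x :: k) = (e n x && (1 <= x)%N) && chain e x k.
Proof. by rewrite /chain /= andbACA. Qed.

Lemma sum_chain0 (V : nmodType) N (e : rel nat) n (F : seq nat -> V) :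
  \sum_(k : 0.-tuple 'I_N.+1 | chain e n [seq val i | i <- k])
    F [seq val i | i <- k] = F [::].
Proof.
exact: (@sum_tuple0 _ 'I_N.+1 (fun k => chain e n [seq val i | i <- k])
  (fun k => F [seq val i | i <- k])).
Qed.

(** Peels off the largest index for both orders: [m] is [n.+1] for [geq] and [n] for [gtn]. The
    index type ['I_N.+1] stays fixed while the bound shrinks. *)
Lemma sum_chainS (V : nmodType) N r (e : rel nat) n m
    (F : seq nat -> V) : (m <= N.+1)%N ->
  (forall x, e n x = (x < m)%N) ->
  \sum_(k : r.+1.-tuple 'I_N.+1 | chain e n [seq val i | i <- k])
    F [seq val i | i <- k] =
  \sum_(1 <= x < m) \sum_(k : r.-tuple 'I_N.+1 | chain e x [seq val i | i <- k])
    F (x :: [seq val i | i <- k]).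
Proof.
move=> mN em.
rewrite (@big_tuple_cons _ 'I_N.+1 r (fun k => chain e n [seq val i | i <- k])
  (fun k => F [seq val i | i <- k])).
rewrite -(@sum_ord_range _ N) //; apply: eq_bigr => x _.
case: ifP => xm; [apply: eq_bigl | apply: big_pred0] => k;
  by rewrite /= chain_cons em xm.
Qed.

Lemma cvgn_sum (R : realType) (I : finType) (F : I -> nat -> R) (l : I -> R) :
  (forall i, (F i @ \oo --> l i)%classic) ->
  ((fun n => \sum_i F i n) @ \oo --> \sum_i l i)%classic.
Proof.
move=> Fl; rewrite -fct_sumE.
apply: (big_ind2 (fun (f : nat -> R) (x : R) => (f @ \oo --> x)%classic)) => //.
  exact: cvg_cst.
by move=> f x g y; apply: cvgD.
Qed.

(** * The kernel and its distance from 1 *)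

Section Kernel.
Variables (R : realType) (q : R).
Hypotheses (q_gt0 : 0 < q) (q_lt1 : q < 1).

Local Notation qn := (qnat q).

(* [kern n k] is (q)_n^2 / ((q)_{n-k} (q)_{n+k}), with (q)_n = (1 - q) ... (1 - q^n);
   the truncated subtraction makes it vanish for k > n. *)
Fixpoint kern n k : R :=
  if k is k'.+1 then kern n k' * ((1 - q ^+ (n - k')) / (1 - q ^+ (n + k)))
  else 1.

Lemma subX_gt0 n : (0 < n)%N -> 0 < 1 - q ^+ n.
Proof. by move=> n0; rewrite subr_gt0 exprn_ilt1 ?ltW -?lt0n. Qed.

Lemma subX_neq0 n : 1 - q ^+ n.+1 != 0.
Proof. by rewrite gt_eqF ?subX_gt0. Qed.

Lemma subX_ge0 n : 0 <= 1 - q ^+ n.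
Proof. by rewrite subr_ge0 exprn_ile1 ?ltW. Qed.

Lemma q_neq0 : q != 0. Proof. by rewrite gt_eqF. Qed.

Lemma sub1q_neq0 : 1 - q != 0. Proof. exact: (subX_neq0 0). Qed.

Lemma qnat_ge1 n : (0 < n)%N -> 1 <= qn n.
Proof.
case: n => // n _; rewrite /qnat ler_pdivlMr ?(subX_gt0 (n := 1)) // mul1r.
by rewrite lerB // exprS ger_pMr // exprn_ile1 ?ltW.
Qed.

Lemma qnat_neq0 n : qn n.+1 != 0.
Proof. by rewrite gt_eqF // (lt_le_trans ltr01) ?qnat_ge1. Qed.

Lemma kern_gt n k : (n < k)%N -> kern n k = 0.
Proof.
elim: k => // k IH; rewrite ltnS leq_eqVlt => /predU1P[-> /=|/IH /= ->].
  by rewrite subnn subrr mul0r mulr0.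
by rewrite mul0r.
Qed.

Lemma kern_01 n k : 0 <= kern n k <= 1.
Proof.
elim: k => [|k /andP[IH0 IH1]] /=; first by rewrite ler01 lexx.
have p : 0 < 1 - q ^+ (n + k.+1) by apply: subX_gt0; rewrite addnS.
rewrite mulr_ge0 ?divr_ge0 ?subX_ge0 // mulr_ile1 ?divr_ge0 ?subX_ge0 //.
rewrite ler_pdivrMr // mul1r lerD2l lerN2.
by apply: ler_wiXn2l; rewrite ?ltW //; lia.
Qed.

(** Multiplying out the denominators keeps the identity true for [k > n], where both sides
    vanish. *)
Lemma kern_succ n k : kern n k * (1 - q ^+ n.+1) ^+ 2 =
  kern n.+1 k * ((1 - q ^+ (n.+1 - k)) * (1 - q ^+ (n.+1 + k))).
Proof.
elim: k => [|k IH]; first by rewrite subn0 addn0 expr2.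
rewrite /= mulrAC IH subSS !addSn !addnS.
have := subX_neq0 (n + k); have := subX_neq0 (n + k).+1.
set a := q ^+ (n + k).+1; set b := q ^+ (n + k).+2.
by move=> ? ?; field; apply/andP.
Qed.

(** The factor of the kernel with index [k'] is at least [1 - q ^+ (n - k')], so the total loss is
    at most a geometric sum, bounded by [q^(n+1-k) / (1 - q)]. The extra [q ^+ k] avoids a truncated
    exponent. *)
Lemma kern_near1 n k : (1 - kern n k) * (1 - q) * q ^+ k <= q ^+ n.+1.
Proof.
have [nk|kn] := ltnP n k.
  rewrite kern_gt // subr0 mul1r (@le_trans _ _ (q ^+ k)) //.
    by rewrite ger_pMl ?exprn_gt0 // gerBl ltW.
  by apply: ler_wiXn2l; rewrite ?ltW.
elim: k kn => [|k IH] kn; first by rewrite subrr !mul0r exprn_ge0 // ltW.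
have {IH} := IH (ltnW kn); have /andP[w0 w1] := kern_01 n k.
have p : 0 < 1 - q ^+ (n + k.+1) by apply: subX_gt0; rewrite addnS.
have le : kern n k * (1 - q ^+ (n - k)) <= kern n k.+1.
  rewrite /= ler_wpM2l // ler_peMr ?subX_ge0 // invr_ge1 ?unitfE ?gt_eqF //.
  by rewrite gerBl exprn_ge0 // ltW.
have -> : q ^+ n.+1 = q * (q ^+ (n - k) * q ^+ k).
  by rewrite -exprD subnK ?exprS // ltnW.
have := exprn_gt0 k q_gt0; have := exprn_gt0 (n - k) q_gt0.
move: le w0 w1; rewrite exprS.
set W := kern n k.+1; set v := kern n k; set a := q ^+ (n - k); set b := q ^+ k.
move=> le v0 v1 a0 b0 IH.
have {}IH : (1 - v) * (1 - q) <= q * a 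
  by rewrite -(ler_pM2r b0); move: IH; rewrite !mulrA.
rewrite mulrCA; apply: ler_wpM2l; first exact: ltW.
rewrite ler_pM2r //.
(* From [W >= v (1 - a)] and [v <= 1] follows [1 - W <= (1 - v) + a]; then [q a + a (1 - q) = a]
   closes the induction. *)
have : (1 - W) * (1 - q) <= (1 - v * (1 - a)) * (1 - q).
  by rewrite ler_pM2r ?subr_gt0 // lerB.
have : v * (a * (1 - q)) <= 1 * (a * (1 - q)).
  by rewrite ler_pM2r // mulr_gt0 // subr_gt0.
lra.
Qed.

(** * Weighted sums and their recursions in [n] *)

Definition kernsum n (T : nat -> R) : R :=
  \sum_(1 <= k < n.+1) kern n k * q ^+ (k ^ 2) * T k.

Lemma eq_kernsum n (S T : nat -> R) :
  (forall k, (0 < k)%N -> S k = T k) -> kernsum n S = kernsum n T.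
Proof. by move=> ST; apply: eq_big_nat => k /andP[k0 _]; rewrite ST. Qed.

Lemma kernsum0 (T : nat -> R) : kernsum 0 T = 0.
Proof. by rewrite /kernsum big_geq. Qed.

(** With [N = n + 1] this rests on [(1 - q^N)^2 - (1 - q^(N-k)) (1 - q^(N+k)) = q^(N-k) (1 -
    q^k)^2]; the power [q^N] moves outside and leaves [q^(k^2-k)]. *)
Lemma kernsumS n (T : nat -> R) : kernsum n.+1 T - kernsum n T =
  q ^+ n.+1 / qn n.+1 ^+ 2 *
  \sum_(1 <= k < n.+2) kern n.+1 k * q ^+ (k ^ 2 - k) * qn k ^+ 2 * T k.
Proof.
(* The range extends to [k = n + 1] because the kernel vanishes there. *)
have -> : kernsum n T = \sum_(1 <= k < n.+2) kern n k * q ^+ (k ^ 2) * T k.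
  by rewrite [RHS]big_nat_recr // kern_gt //= !mul0r addr0.
rewrite /kernsum -sumrB big_distrr /=; apply: eq_big_nat => k /andP[k0 kn].
have -> : kern n k = kern n.+1 k *
    ((1 - q ^+ (n.+1 - k)) * (1 - q ^+ (n.+1 + k))) / (1 - q ^+ n.+1) ^+ 2.
  by rewrite -kern_succ mulfK // expf_neq0 // subX_neq0.
have -> : q ^+ n.+1 = q ^+ (n.+1 - k) * q ^+ k.
  by rewrite -exprD subnK.
have -> : q ^+ (n.+1 + k) = q ^+ (n.+1 - k) * q ^+ k * q ^+ k.
  by rewrite -!exprD; congr (_ ^+ _); lia.
have -> : q ^+ (k ^ 2) = q ^+ (k ^ 2 - k) * q ^+ k.
  by rewrite -exprD; congr (_ ^+ _); nia.
rewrite /qnat; have := subX_neq0 n; rewrite -{1}(subnK (ltnSE kn : (k <= n.+1)%N)).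
rewrite exprD; have -> : q ^+ n.+1 = q ^+ (n.+1 - k) * q ^+ k.
  by rewrite -exprD subnK.
have := sub1q_neq0.
set a := q ^+ (n.+1 - k); set b := q ^+ k => ? ?.
by field; apply/andP.
Qed.

(** In the increment given by [kernsumS], the factor [qn k ^+ 2] cancels the new denominator and
    [q ^+ k] restores the exponent [k ^ 2]. *)
Lemma kernsum_prepend2 n (T : nat -> R) :
  kernsum n (fun k => q ^+ k / qn k ^+ 2 * T k) =
  \sum_(1 <= k < n.+1) q ^+ k / qn k ^+ 2 * kernsum k T.
Proof.
elim: n => [|n IH]; first by rewrite kernsum0 big_geq.
rewrite big_nat_recr //= -IH.
rewrite -[LHS](subrK (kernsum n (fun k => q ^+ k / qn k ^+ 2 * T k))).
rewrite kernsumS [RHS]addrC; congr (_ * _ + _); apply: eq_big_nat => -[//|k] _.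
have -> : q ^+ (k.+1 ^ 2) = q ^+ (k.+1 ^ 2 - k.+1) * q ^+ k.+1.
  by rewrite -exprD; congr (_ ^+ _); nia.
by have := qnat_neq0 k; set W := kern _ _ => ?; field.
Qed.

(* Abel summation: the weights on the left are the decrements of
   [k |-> (qn N - qn k) * q ^+ (k ^ 2) * kern N k]. *)
Lemma kernsum_abel N (T : nat -> R) M :
  \sum_(1 <= k < M.+1) kern N k * q ^+ (k ^ 2 - k) * ((1 + q ^+ k) * qn k) *
     (\sum_(1 <= j < k) T j) =
  \sum_(1 <= k < M.+1) (qn N - qn k) * q ^+ (k ^ 2) * kern N k * T k
  - (qn N - qn M) * q ^+ (M ^ 2) * kern N M * \sum_(1 <= j < M.+1) T j.
Proof.
elim: M => [|M IH]; first by rewrite !big_geq // mulr0 subr0.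
rewrite big_nat_recr //= IH [in RHS]big_nat_recr //=.
rewrite [in X in _ = _ - X]big_nat_recr //=.
set S := \sum_(1 <= j < M.+1) T j; set A := \sum_(1 <= k < M.+1) _.
(* For [N <= M] the kernel vanishes at [M.+1]. The old boundary term is 0 as well, through
   [qn N - qn M] if [N = M] and through the kernel if [N < M]. *)
have [NM|MN] := leqP N M.
  rewrite (_ : _ / _ = 0); last by rewrite (_ : (N - M = 0)%N) ?subrr ?mul0r //; lia.
  rewrite mulr0 !(mul0r, mulr0) !addr0; have [->|NeM] := eqVneq N M.
    by rewrite subrr !mul0r.
  by rewrite kern_gt ?(mulr0, mul0r) // ltn_neqAle NeM.
have -> : q ^+ (N + M.+1) = q ^+ (N - M) * q ^+ M * q ^+ M * q.
  by rewrite -!exprD -exprSr; congr (_ ^+ _); lia.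
have -> : q ^+ (M.+1 ^ 2 - M.+1) = q ^+ (M ^ 2) * q ^+ M.
  by rewrite -!exprD; congr (_ ^+ _); nia.
have -> : q ^+ (M.+1 ^ 2) = q ^+ (M ^ 2) * q ^+ M * q ^+ M * q.
  by rewrite -!exprD -exprSr; congr (_ ^+ _); nia.
rewrite /qnat exprSr.
have -> : q ^+ N = q ^+ (N - M) * q ^+ M by rewrite -exprD subnK // ltnW.
have : 1 - q ^+ (N - M) * q ^+ M * q ^+ M * q != 0.
  by rewrite -!exprD -exprSr subX_neq0.
have := sub1q_neq0 => ? ?.
by field; apply/andP.
Qed.

(** The two summands on the left are the outcomes of a plus and of a comma. In the increment, Abel
    summation turns the nested sum into weights [qn n.+1 - qn k]; the plus supplies the missing
    [qn k], and only the constant [qn n.+1] remains. *)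
Lemma kernsum_prepend1 n (T : nat -> R) :
  kernsum n (fun k => q ^+ k / qn k * T k +
                (1 + q ^+ k) / qn k * \sum_(1 <= j < k) T j) =
  \sum_(1 <= k < n.+1) q ^+ k / qn k * kernsum k T.
Proof.
elim: n => [|n IH]; first by rewrite kernsum0 big_geq.
rewrite big_nat_recr //= -IH; set T' := (fun k => _).
rewrite -[LHS](subrK (kernsum n T')) kernsumS [RHS]addrC; congr (_ + _).
rewrite (_ : _ / qn n.+1 * _ =
  q ^+ n.+1 / qn n.+1 ^+ 2 * (qn n.+1 * kernsum n.+1 T)); last first.
  by have := qnat_neq0 n => ?; field.
congr (_ * _).
transitivity (\sum_(1 <= k < n.+2) kern n.+1 k * q ^+ (k ^ 2) * qn k * T k +
  \sum_(1 <= k < n.+2) kern n.+1 k * q ^+ (k ^ 2 - k) * ((1 + q ^+ k) * qn k) *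
     (\sum_(1 <= j < k) T j)).
  rewrite -big_split; apply: eq_big_nat => -[//|k] _; rewrite /T'.
  have -> : q ^+ (k.+1 ^ 2) = q ^+ (k.+1 ^ 2 - k.+1) * q ^+ k.+1.
    by rewrite -exprD; congr (_ ^+ _); nia.
  by have := qnat_neq0 k; set W := kern _ _ => ?; rewrite /=; field.
(* Here [M = N], so the boundary term of the Abel summation is 0. *)
rewrite kernsum_abel subrr !mul0r subr0 -big_split big_distrr /=.
by apply: eq_bigr => k _; ring.
Qed.

(** Base of the recursion: the empty star sum is 1, and the summand is that of z-bar for the
    one-entry tuples with entry 0. *)
Lemma kernsum_nil n : (0 < n)%N ->
  kernsum n (fun k => (-1) ^+ (k - 1) / q ^+ (k * (k - 1))./2 *
    ((1 + q ^+ k) / q ^+ k))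
  = 1.
Proof.
move=> n0.
(* Closed form of the partial sums; at [M = n] the factor [1 - q ^+ (n - M)] kills the remainder. *)
suff E M : \sum_(1 <= k < M.+1) kern n k * q ^+ (k ^ 2) *
    ((-1) ^+ (k - 1) / q ^+ (k * (k - 1))./2 * ((1 + q ^+ k) / q ^+ k)) =
    1 - (-1) ^+ M * q ^+ (M.+1 * M)./2 * kern n M *
      ((1 - q ^+ (n - M)) / (1 - q ^+ n)).
  by rewrite /kernsum E subnn subrr mul0r mulr0 subr0.
elim: M => [|M IH].
  rewrite big_geq // subn0 muln0 !mul1r divff ?subrr //.
  by rewrite gt_eqF // subX_gt0.
rewrite big_nat_recr // IH -[LHS]/(_ + _) [kern n M.+1]/=.
(* From [M = n] on, truncated subtraction makes both the new term and the remainder 0. *)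
have [nM|Mn] := leqP n M.
  move: (nM); rewrite -subn_eq0 => /eqP e; rewrite subnS e.
  by rewrite subrr !(mul0r, mulr0) addr0.
have tri : ((M.+2 * M.+1)./2 = (M.+1 * M)./2 + M.+1)%N.
  have -> : (M.+2 * M.+1 = M.+1 * M + M.+1.*2)%N by lia.
  by rewrite halfD odd_double doubleK andbF.
have -> : (M.+1 - 1 = M)%N by lia.
have -> : q ^+ (M.+1 ^ 2) = q ^+ (M.+1 * M)./2 * q ^+ (M.+1 * M)./2 * q ^+ M.+1.
  rewrite -!exprD; congr (_ ^+ _).
  have : odd (M.+1 * M) = false by rewrite oddM /= andNb.
  by move=> od; have := odd_double_half (M.+1 * M); rewrite od; lia.
rewrite tri (exprD q (M.+1 * M)./2) (exprS (-1) M).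
have -> : q ^+ (n + M.+1) = q ^+ (n - M.+1) * q ^+ M.+1 * q ^+ M.+1.
  by rewrite -!exprD; congr (_ ^+ _); lia.
have -> : q ^+ n = q ^+ (n - M.+1) * q ^+ M.+1.
  by rewrite -exprD subnK.

have : 1 - q ^+ (n - M.+1) * q ^+ M.+1 != 0.
  by rewrite -exprD subnK // gt_eqF // subX_gt0.
have : 1 - q ^+ (n - M.+1) * q ^+ M.+1 * q ^+ M.+1 != 0.
  by rewrite -!exprD gt_eqF // subX_gt0 // addnS.
have : q ^+ (M.+1 * M)./2 != 0 by rewrite expf_neq0 ?q_neq0.
have : q ^+ M.+1 != 0 by rewrite expf_neq0 ?q_neq0.
set a := q ^+ (_ - M.+1); set b := q ^+ M.+1; set c := q ^+ _./2.
set d := 1 - q ^+ _; set v := kern n M; set e := (-1) ^+ M => ? ? ? ?.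
by field; repeat (apply/andP; split).
Qed.

(** * Summation over all choices of commas and pluses *)

Definition zfactor (s t : int) k : R :=
  (1 + q ^+ k) * q ^ ((t - 1) * k%:Z) / qn k ^ s.

Definition zlast k : R := (-1) ^+ (k - 1) / q ^+ (k * (k - 1))./2.

(* The part of the series z-bar with largest index [k], without [q ^+ (k ^ 2)]. *)
Fixpoint zinner (s t : seq int) k : R :=
  if s is x :: s' then
    zfactor x (head 0 t) k *
    (if s' is [::] then zlast k else \sum_(1 <= j < k) zinner s' (behead t) j)
  else 0.

(** Computes the sum of [zinner] over all choices of symbols in the shape of the recursions for
    [kernsum]: the term in [zinner_sum s' u k] is the plus, the sum over [j < k] the comma. *)
Fixpoint zinner_sum (s : seq nat) (u : nat) k : R :=
  if s is a :: s' then
    (q ^+ k / qn k ^+ 2) ^+ a *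
    (q ^+ k / qn k * zinner_sum s' u k +
     (1 + q ^+ k) / qn k * \sum_(1 <= j < k) zinner_sum s' u j)
  else zinner [:: (2 * u)%N%:Z] [:: u%:Z] k.

Fixpoint star_sum (l : seq int) n : R :=
  if l is a :: l' then \sum_(1 <= k < n.+1) q ^+ k / qn k ^ a * star_sum l' k
  else 1.

(** Exponents add under a plus, whereas [1 + q ^+ k] and the shift [t - 1] occur once per merged
    entry. *)
Lemma zfactorD (a b : nat) (s t : int) k : (0 < k)%N ->
  zfactor (a%:Z + s) (b%:Z + t) k = q ^+ (b * k) / qn k ^+ a * zfactor s t k.
Proof.
case: k => // k _; rewrite /zfactor.
have -> : (b%:Z + t - 1) * k.+1%:Z = (b * k.+1)%N%:Z + (t - 1) * k.+1%:Z.
  by rewrite PoszM; ring.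
rewrite !expfzDr ?q_neq0 ?qnat_neq0 // -!exprnP invfM; ring.
Qed.

Lemma zfactor_odd a k : (0 < k)%N ->
  zfactor (2 * a + 1)%N%:Z (a + 1)%N%:Z k =
  (q ^+ k / qn k ^+ 2) ^+ a * ((1 + q ^+ k) / qn k).
Proof.
move=> k0; rewrite (PoszD (2 * a)) (PoszD a) zfactorD //.
rewrite (mulnC a) (exprM q) (exprM (qn k)) -expr_div_n.
by congr (_ * _); rewrite /zfactor subrr mul0r expr0z mulr1 expr1z.
Qed.

Lemma zfactor_even a k : (0 < k)%N ->
  zfactor (2 * a)%N%:Z a%:Z k =
  (q ^+ k / qn k ^+ 2) ^+ a * ((1 + q ^+ k) / q ^+ k).
Proof.
move=> k0; rewrite -[(2 * a)%N%:Z]addr0 -[a%:Z in X in X = _]addr0 zfactorD //.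
rewrite (mulnC a) (exprM q) (exprM (qn k)) -expr_div_n; congr (_ * _).
by rewrite /zfactor expr0z divr1 sub0r mulN1r -exprnN.
Qed.

Lemma star_sum_nseq2 a l (T : nat -> R) :
  (forall n, (0 < n)%N -> star_sum l n = kernsum n T) ->
  forall n, (0 < n)%N -> star_sum (nseq a 2%:Z ++ l) n =
    kernsum n (fun k => (q ^+ k / qn k ^+ 2) ^+ a * T k).
Proof.
move=> IHl; elim: a => [|a IH] n n0 /=.
  by rewrite IHl //; apply: eq_kernsum => k _; rewrite mul1r.
rewrite (@eq_kernsum _ _ (fun k => q ^+ k / qn k ^+ 2 *
  ((q ^+ k / qn k ^+ 2) ^+ a * T k))); last by move=> k _; rewrite exprS mulrA.
by rewrite kernsum_prepend2; apply: eq_big_nat => k /andP[k0 _]; rewrite IH.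
Qed.

(** The exact finite identity: each block of 2s followed by a 1 is one use of [kernsum_prepend1] and
    then repeated use of [kernsum_prepend2], starting from [kernsum_nil]. *)
Lemma star_sum_star_string s u n : (0 < n)%N ->
  star_sum (star_string s u) n = kernsum n (zinner_sum s u).
Proof.
elim: s n => [|a s IH] n n0.
  rewrite /star_string /= -[nseq u _]cats0.
  rewrite (@star_sum_nseq2 _ _ (fun k => zlast k * ((1 + q ^+ k) / q ^+ k))) //.
    apply: eq_kernsum => k k0 /=.
    by rewrite zfactor_even // -mulrA [_ * zlast k]mulrC.
  by move=> {}n {}n0; rewrite kernsum_nil.
have -> : star_string (a :: s) u = nseq a 2%:Z ++ 1%:Z :: star_string s u.
  by rewrite /star_string /= -cats1 -!catA.
apply: star_sum_nseq2 => // {}n {}n0 /=; rewrite kernsum_prepend1.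
by apply: eq_big_nat => k /andP[k0 _]; rewrite IH // expr1z.
Qed.

Lemma zinner_sum_compose m s u k : size s = m -> (0 < k)%N ->
  \sum_(c : m.-tuple bool)
    zinner (compose c (p_entries s u)) (compose c (ptilde_entries s u)) k =
  zinner_sum s u k.
Proof.
elim: m s k => [|m IH] [|a s] k //= => [_ k0|[sm] k0].
  by rewrite (@sum_tuple0 _ _ xpredT
  (fun c => zinner (compose c _) (compose c _) k)).
rewrite (@big_tuple_cons _ _ _ xpredT
  (fun c => zinner (compose c _) (compose c _) k)).
rewrite big_bool mulrDr; congr (_ + _).
  (* First symbol a plus: the leading entries of the merged remainder absorb [2 * a + 1] and
     [a + 1]. *)
  rewrite -(IH _ _ sm k0) !big_distrr; apply: eq_bigr => c _ /=.
  have := @size_compose c (p_entries s u) (ptilde_entries s u).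
  have := @compose_neq_nil c (p_entries s u).
  rewrite !size_rcons !size_map => /(_ isT) + /(_ erefl).
  case: (compose c (p_entries s u)) => // x p _.
  case: (compose c (ptilde_entries s u)) => // y t _ /=.
  rewrite zfactorD // -[LHS]mulrA [RHS]mulrA; congr (_ * _).
  rewrite !addn1 mulSn exprD exprS (mulnC a) !exprM (expr_div_n _ (qn k ^+ 2)).
  by rewrite invfM mulrACA mulrC.
(* First symbol a comma: [k] carries the first block alone and the remainder runs over [j < k]. *)
transitivity (\sum_(c : m.-tuple bool)
  (q ^+ k / qn k ^+ 2) ^+ a * ((1 + q ^+ k) / qn k) *
  \sum_(1 <= j < k)
    zinner (compose c (p_entries s u)) (compose c (ptilde_entries s u)) j).
  apply: eq_bigr => c _ /=; rewrite zfactor_odd //.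
  have := @compose_neq_nil c (p_entries s u); rewrite size_rcons => /(_ isT).
  by case: (compose c (p_entries s u)).
rewrite -big_distrr /= [RHS]mulrA exchange_big /=. congr (_ * _).
by apply: eq_big_nat => j /andP[j0 _]; rewrite IH.
Qed.

(** * Truncated series as nested sums *)

Definition star_term (l : seq int) (k : seq nat) : R :=
  \prod_(j < size l) (q ^+ nth 0%N k j / qn (nth 0%N k j) ^ l`_j).

Lemma star_term_cons a l x k :
  star_term (a :: l) (x :: k) = q ^+ x / qn x ^ a * star_term l k.
Proof. by rewrite /star_term big_ord_recl. Qed.

Definition zbar_prod (s t : seq int) (k : seq nat) : R :=
  zlast (last 0%N k) * \prod_(j < size s) zfactor s`_j t`_j (nth 0%N k j).

Lemma zbar_prod_cons a s t x k : (0 < size k)%N ->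
  zbar_prod (a :: s) t (x :: k) = zfactor a (head 0 t) x * zbar_prod s (behead t) k.
Proof.
case: k => // y k _; rewrite /zbar_prod big_ord_recl /= nth0 mulrCA.
by congr (_ * (_ * _)); apply: eq_bigr => j _; rewrite nth_behead.
Qed.

Lemma star_sum_tuple N (l : seq int) n : (n <= N)%N ->
  \sum_(k : (size l).-tuple 'I_N.+1 | chain geq n [seq val i | i <- k])
    star_term l [seq val i | i <- k] = star_sum l n.
Proof.
elim: l n => [|a l IH] n nN /=; first by rewrite sum_chain0 /star_term big_ord0.
rewrite (@sum_chainS _ _ _ _ _ n.+1) //.
apply: eq_big_nat => x /andP[x0 xn]; rewrite -IH; last first.
  exact: leq_trans (ltnSE xn) nN.
by rewrite big_distrr; apply: eq_bigr => k _; rewrite star_term_cons.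
Qed.

Lemma zeta_star_truncE (l : seq int) n : zeta_star_trunc q l n = star_sum l n.
Proof.
rewrite -(@star_sum_tuple n) // /zeta_star_trunc; apply: eq_big => k /=.
  congr (_ && _); case: (tval k) => [|x s] //=.
  by rewrite -ltnS ltn_ord.
move=> _; apply: eq_bigr => j _.
by rewrite (nth_map (tnth_default k j)) ?size_tuple // -tnth_nth.
Qed.

(** The weight [G] sees the largest index only: it becomes [q ^+ (k ^ 2)] in the application and the
    constant 1 in the induction hypothesis. *)
Lemma zinner_tuple N (G : nat -> R) (s t : seq int) n :
  (0 < size s)%N -> (n <= N.+1)%N ->
  \sum_(k : (size s).-tuple 'I_N.+1 | chain gtn n [seq val i | i <- k])
    G (head 0%N [seq val i | i <- k]) * zbar_prod s t [seq val i | i <- k] =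
  \sum_(1 <= k < n) G k * zinner s t k.
Proof.
elim: s t n G => [//|a s IH] t n G _ nN.
rewrite [LHS](@sum_chainS _ _ (size s) gtn n n
  (fun k => G (head 0%N k) * zbar_prod (a :: s) t k)) //.
apply: eq_big_nat => x /andP[x0 xn] /=; rewrite -big_distrr; congr (_ * _).
case: s IH => [_|b s IH].
  rewrite (sum_chain0 _ _ _ (fun k => zbar_prod [:: a] t (x :: k))).
  by rewrite /zbar_prod big_ord_recl big_ord0 mulr1 nth0 mulrC.
transitivity (zfactor a (head 0 t) x *
    \sum_(1 <= k < x) 1 * zinner (b :: s) (behead t) k); last first.
  by congr (_ * _); apply: eq_bigr => k _; rewrite mul1r.
rewrite -(IH _ _ (fun=> 1)) ?(leq_trans (ltnW xn)) // big_distrr.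
by apply: eq_bigr => k _; rewrite mul1r zbar_prod_cons // size_map size_tuple.
Qed.

Lemma zbar_truncE (s t : seq int) n : (0 < size s)%N ->
  zbar_trunc q s t n = \sum_(1 <= k < n.+1) q ^+ (k ^ 2) * zinner s t k.
Proof.
move=> s0; rewrite -(@zinner_tuple n (fun k => q ^+ (k ^ 2))) // /zbar_trunc.
apply: eq_big => k /=.
  by congr (_ && _); case: (tval k) => [|x l] //=; rewrite ltn_ord.
case/andP => so _; rewrite /zbar_term mulrA; congr (_ * _).
set l := [seq _ | i <- k] in so *.
(* This inequality between [k_r] and [k_1] makes the subtraction in the exponent of [q] exact, so
   the power splits as a quotient. *)
have le : (last 0%N l <= head 0%N l)%N.
  case: l so => [|x l] //= /(order_path_min (rev_trans ltn_trans)) /allP xl.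
  by have := mem_last x l; rewrite inE => /predU1P[->//|/xl /ltnW].
have tri (a b : nat) : (a <= b)%N -> ((a * (a - 1))./2 <= b ^ 2)%N.
  move=> ab; apply: (@leq_trans (a * (a - 1))); last by nia.
  by rewrite leq_half_double -addnn; lia.
rewrite /zlast mulrCA; congr (_ * _).
by rewrite expfB_cond ?tri // ?(negPf q_neq0) ?add0n ?tri.
Qed.

(** * Estimates and convergence *)

Lemma zfactor_le2 (s t : int) k : (0 < k)%N -> 0 <= s -> 1 <= t ->
  `|zfactor s t k| <= 2.
Proof.
move=> k0; case: s => // s _ t1.
have [m ->] : exists m : nat, t = m%:Z + 1.
  by case: t t1 => [[|m]|m] // _; exists m; rewrite -addn1 PoszD.
have q1 n : q ^+ n <= 1 by apply: exprn_ile1; rewrite ltW.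
have q0 n : 0 <= q ^+ n by apply: exprn_ge0; rewrite ltW.
have Q1 : 1 <= qn k ^+ s by apply: exprn_ege1; apply: qnat_ge1.
rewrite /zfactor addrK -PoszM -!exprnP ger0_norm; last first.
  by rewrite divr_ge0 ?mulr_ge0 ?addr_ge0 // (le_trans ler01).
rewrite ler_pdivrMr ?(lt_le_trans ltr01) //.
apply: le_trans (_ : 2 * 1 <= _); last by rewrite ler_wpM2l.
by apply: ler_pM; rewrite ?addr_ge0 // lerD2l.
Qed.

(** Each [q ^+ j] with [j < n] is at least [q ^+ n], so [n q^n] is at most the geometric sum
    [(1 - q^n) / (1 - q)]. *)
Lemma mulrn_expr_le n : n%:R * q ^+ n <= (1 - q)^-1.
Proof.
rewrite -[leRHS]mul1r ler_pdivlMr ?subr_gt0 //.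
suff : n%:R * q ^+ n * (1 - q) <= 1 - q ^+ n.
  by move/le_trans; apply; rewrite gerBl exprn_ge0 // ltW.
elim: n => [|n IH]; first by rewrite !mul0r subrr.
have := ler_wpM2l (ltW q_gt0) IH; have := mulr_ge0 (subX_ge0 1) (subX_ge0 n.+1).
rewrite (exprS q n) expr1 -natr1; lra.
Qed.

Lemma zinner_bound (s t : seq int) : size s = size t ->
  all (>= 0) s -> all (>= 1) t ->
  exists C, forall k, (0 < k)%N -> `|zinner s t k| * q ^+ (k * (k - 1))./2 <= C.
Proof.
have q0 n : 0 <= q ^+ n by apply: exprn_ge0; rewrite ltW.
elim: s t => [|a s IH] [|b t] //= => [_ _ _|[] st /andP[a0 s0] /andP[b1 t1]].
  by exists 0 => k _; rewrite normr0 mul0r.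
have [C CP] := IH t st s0 t1; case: s {st s0 IH} CP => [_|x s CP].
  exists 2 => k k0; rewrite normrM -mulrA.
  suff -> : `|zlast k| * q ^+ (k * (k - 1))./2 = 1 by rewrite mulr1 zfactor_le2.
  rewrite /zlast normrM normrX normrN1 expr1n mul1r ger0_norm ?invr_ge0 //.
  by rewrite mulVf ?expf_neq0 ?q_neq0.
have C0 : 0 <= C by apply: le_trans (CP 1%N isT); rewrite mulr_ge0.
exists (2 * (C / (1 - q))) => k k0; rewrite normrM -mulrA.
apply: ler_pM; rewrite ?mulr_ge0 ?zfactor_le2 //.
(* For [j < k] one has [k(k-1)/2 >= j(j-1)/2 + (k-1)], so each of the [k - 1] inner terms is at most
   [C * q ^+ (k - 1)]. *)
apply: (@le_trans _ _ (\sum_(1 <= j < k) C * q ^+ (k - 1))); last first.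
  rewrite sumr_const_nat -mulrnAr ler_wpM2l // -mulr_natl.
  exact: mulrn_expr_le.
apply: le_trans (ler_wpM2r (q0 _) (ler_norm_sum _ _ _)) _.
rewrite mulr_suml; apply: ler_sum_nat => j /andP[j0 jk].
apply: le_trans (ler_wpM2r (q0 _) (CP j j0)); rewrite -mulrA ler_wpM2l //.
rewrite -exprD; apply: ler_wiXn2l; rewrite ?ltW //.
have -> : (k * (k - 1) = (k - 1) * (k - 2) + (k - 1).*2)%N by nia.
rewrite halfD odd_double andbF doubleK leq_add2r half_leq //.
by nia.
Qed.

Lemma zinner_decay (s t : seq int) : size s = size t ->
  all (>= 0) s -> all (>= 1) t ->
  exists C, forall k, (0 < k)%N ->
    `|q ^+ (k ^ 2) * zinner s t k| <= C * q ^+ (2 * k).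
Proof.
move=> st s0 t1; have [C CP] := zinner_bound st s0 t1.
have C0 : 0 <= C by apply: le_trans (CP 1%N isT);
  rewrite mulr_ge0 // exprn_ge0 // ltW.
(* The remaining exponent [k^2 - k(k-1)/2 = k(k+1)/2] is at least [2k - 1], as [(k-1)(k-2) >= 0];
   the division by [q] makes up for the missing 1. *)
exists (C / q) => k k0; rewrite normrM ger0_norm ?exprn_ge0 ?(ltW q_gt0) //.
have E : (2 * k - 1 + (k * (k - 1))./2 <= k ^ 2)%N.
  have := half_leq (_ : k * (k - 1) <= (k ^ 2 - (2 * k - 1)).*2)%N.
  by rewrite doubleK => /(_ ltac:(nia)); nia.
have -> : C / q * q ^+ (2 * k) = q ^+ (2 * k - 1) * C.
  have -> : (2 * k = (2 * k - 1).+1)%N by lia.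
  by rewrite subSS subn0 exprS; have := q_neq0 => ?; field.
apply: (@le_trans _ _ (q ^+ (2 * k - 1) *
  (`|zinner s t k| * q ^+ (k * (k - 1))./2))).
  rewrite mulrCA [leLHS]mulrC -exprD ler_wpM2l //.
  by apply: ler_wiXn2l; rewrite ?ltW.
by rewrite ler_wpM2l ?CP // exprn_ge0 // ltW.
Qed.

Lemma sum_expr_le n : \sum_(1 <= k < n.+1) q ^+ k <= (1 - q)^-1.
Proof.
rewrite -[leRHS]mul1r ler_pdivlMr ?subr_gt0 //.
suff : (\sum_(1 <= k < n.+1) q ^+ k) * (1 - q) <= q - q ^+ n.+1.
  move/le_trans; apply; have := exprn_gt0 n.+1 q_gt0; have := q_lt1; lra.
elim: n => [|n IH]; first by rewrite big_geq // mul0r subrr.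
rewrite big_nat_recr //= mulrDl (exprS _ n.+1); lra.
Qed.

Lemma cvg_decay (a : nat -> R) C :
  (forall k, (0 < k)%N -> `|a k| <= C * q ^+ (2 * k)) ->
  cvgn (fun n => \sum_(1 <= k < n.+1) a k).
Proof.
move=> aP; have C0 : 0 <= C.
  rewrite -(pmulr_lge0 _ (exprn_gt0 2 q_gt0)).
  by apply: le_trans (aP 1%N isT).
have -> : (fun n => \sum_(1 <= k < n.+1) a k) = series (fun k => a k.+1).
  by apply: funext => n; rewrite /series /= big_add1.
apply: normed_cvg; apply: (@series_le_cvg _ _ (geometric C q)) => [n|n|n|] //=.
- by rewrite mulr_ge0 // exprn_ge0 // ltW.
- apply: le_trans (aP _ _) _ => //; apply: ler_wpM2l => //.
  by apply: ler_wiXn2l; rewrite ?ltW //; lia.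
- by apply: is_cvg_geometric_series; rewrite ger0_norm // ltW.
Qed.

(** One factor [q ^+ k] of the decay pays for [kern_near1], the other is summed over [k]; what is
    left is a multiple of [q ^+ n.+1]. *)
Lemma cvg_kernel (a : nat -> R) C :
  (forall k, (0 < k)%N -> `|a k| <= C * q ^+ (2 * k)) ->
  ((fun n => \sum_(1 <= k < n.+1) (1 - kern n k) * a k) @ \oo --> 0)%classic.
Proof.
move=> aP; have C0 : 0 <= C.
  rewrite -(pmulr_lge0 _ (exprn_gt0 2 q_gt0)).
  by apply: le_trans (aP 1%N isT).
pose D := C * q / (1 - q) ^+ 2.
apply: norm_cvg0; apply: (@squeeze_cvgr _ _ _ _ (fun=> 0) (geometric D q)).
- apply: nearW => n; rewrite normr_ge0 /=.
  apply: le_trans (ler_norm_sum _ _ _) _.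
  apply: (@le_trans _ _ (\sum_(1 <= k < n.+1) C * (q ^+ n.+1 / (1 - q)) * q ^+ k)).
    apply: ler_sum_nat => k /andP[k0 _]; have /andP[w0 w1] := kern_01 n k.
    rewrite normrM ger0_norm ?subr_ge0 //.
    apply: le_trans (ler_wpM2l _ (aP k k0)) _; rewrite ?subr_ge0 //.
    rewrite mul2n -addnn exprD mulrCA -mulrA ler_wpM2l // !mulrA.
    rewrite ler_wpM2r ?exprn_ge0 ?(ltW q_gt0) // ler_pdivlMr ?subr_gt0 //.
    by rewrite mulrAC kern_near1.
  rewrite -big_distrr /= /D.
  have -> : C * q / (1 - q) ^+ 2 * q ^+ n = C * (q ^+ n.+1 / (1 - q)) * (1 - q)^-1.
    by rewrite (exprS q n); have := sub1q_neq0 => ?; field.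
  rewrite ler_wpM2l ?sum_expr_le // mulr_ge0 // divr_ge0 ?subr_ge0 ?ltW //.
  by rewrite exprn_gt0.
- exact: cvg_cst.
- by apply: cvg_geometric; rewrite ger0_norm // ltW.
Qed.

End Kernel.

Theorem theorem1p2 (R : realType) (q : R) (q_gt0 : 0 < q) (q_lt1 : q < 1)
    (m : nat) (s : m.-tuple nat) (u : nat) (u_gt0 : (0 < u)%N) :
  [/\ cvgn (zeta_star_trunc q (star_string s u)),
      forall c : m.-tuple bool,
        cvgn (zbar_trunc q (compose c (p_entries s u))
                           (compose c (ptilde_entries s u)))
    & zeta_star q (star_string s u) =
      \sum_(c : m.-tuple bool)
        zbar q (compose c (p_entries s u)) (compose c (ptilde_entries s u))].
Proof.
pose p (c : m.-tuple bool) := compose c (p_entries s u).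
pose t (c : m.-tuple bool) := compose c (ptilde_entries s u).
have szp : size (p_entries s u) = m.+1 by rewrite size_rcons size_map size_tuple.
have szt : size (ptilde_entries s u) = m.+1.
  by rewrite size_rcons size_map size_tuple.
have p0 c : (0 < size (p c))%N by apply: compose_neq_nil; rewrite szp.
have pt c : size (p c) = size (t c) by apply: size_compose; rewrite szp szt.
have p_ge0 c : all (>= 0) (p c).
  apply: (@compose_ge 0); rewrite ?szp ?szt ?size_tuple //.
  rewrite /p_entries all_rcons /=.
  by rewrite all_map; apply/allP.
(* Here [0 < u] enters: [u] is itself the last entry of [ptilde_entries s u]. *)
have t_ge1 c : all (>= 1) (t c).
  apply: (@compose_ge 1); rewrite ?szp ?szt ?size_tuple //.
  rewrite /ptilde_entries all_rcons /=.
  by rewrite lez_nat u_gt0 all_map; apply/allP => x _ /=; rewrite lez_nat addn1.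
pose f c k := q ^+ (k ^ 2) * zinner q (p c) (t c) k.
have zE c : zbar_trunc q (p c) (t c) = (fun n => \sum_(1 <= k < n.+1) f c k).
  by apply: funext => n; rewrite zbar_truncE.
have zcvg c : cvgn (zbar_trunc q (p c) (t c)).
  rewrite zE; have [C CP] := zinner_decay q_gt0 q_lt1 (pt c) (p_ge0 c) (t_ge1 c).
  exact: (cvg_decay q_gt0 q_lt1 CP).
suff lim_star : (zeta_star_trunc q (star_string s u) @ \oo -->
    \sum_(c : m.-tuple bool) zbar q (p c) (t c))%classic.
  split; [by apply/cvg_ex; eexists; exact: lim_star | exact: zcvg |].
  exact/cvg_lim.
(* The finite identity, with the kernel written as [1 - (1 - kern q n k)] to separate the truncated
   z-bar series from an error that tends to 0. *)
have starE n : (0 < n)%N -> zeta_star_trunc q (star_string s u) n =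
    \sum_(c : m.-tuple bool) (zbar_trunc q (p c) (t c) n -
      \sum_(1 <= k < n.+1) (1 - kern q n k) * f c k).
  move=> n0; rewrite zeta_star_truncE star_sum_star_string // /kernsum.
  transitivity (\sum_(c : m.-tuple bool) \sum_(1 <= k < n.+1) kern q n k * f c k).
    rewrite exchange_big; apply: eq_big_nat => k /andP[k0 _] /=.
    rewrite -(zinner_sum_compose q_gt0 q_lt1 u (size_tuple s) k0) big_distrr /=.
    by apply: eq_bigr => c _; rewrite mulrA.
  apply: eq_bigr => c _; rewrite zE -sumrB; apply: eq_bigr => k _.
  by rewrite mulrBl mul1r opprB addrC subrK.
pose G n := \sum_(c : m.-tuple bool) (zbar_trunc q (p c) (t c) n -
  \sum_(1 <= k < n.+1) (1 - kern q n k) * f c k).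
(* [starE] covers [n > 0] only, so the limit is taken along [n + 1]. *)
rewrite -(cvg_shiftn 1) (_ : (fun n => _) = (fun n => G (n + 1)%N)); last first.
  by apply: funext => n; rewrite /= starE ?addn1.
rewrite (cvg_shiftn 1 G); apply: cvgn_sum => c.
rewrite -[zbar _ _ _]subr0; apply: cvgB; first exact: zcvg.
have [C CP] := zinner_decay q_gt0 q_lt1 (pt c) (p_ge0 c) (t_ge1 c).
exact: (cvg_kernel q_gt0 q_lt1 CP).
Qed.
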